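(* Let $n\equiv0\pmod 4$ and let $C$ be a Type III code of length $n$. Let $\mathrm{III}_n$ be the set of all Type III codes of length $n$. Then: \[ \text{(i)}\quad \frac1{|\mathrm{III}_n|}\sum_{D\in\mathrm{III}_n}|C\cap D|=4-\frac{4}{3^{n/2-1}+1}; \] \[ \text{(ii)}\quad \frac1{|\mathrm{III}_n|}\sum_{D\in\mathrm{III}_n}|C\cap D|^2=\frac{40\,(3^{n/2})^2}{(3^{n/2}+3)(3^{n/2}+9)}. \]
   Context: A Type III code of length $n$ ($n\equiv0\pmod4$) is a self-dual linear code $C\subseteq\mathbb F_3^n$, i.e. $C=C^\perp$ with respect to the inner product $u\cdot v=\sum_i u_iv_i$, in which every codeword has Hamming weight divisible by $3$. Such codes have dimension $n/2$. *)

(* Defs.v *)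
From HB Require Import structures.
From mathcomp Require Import all_boot all_order all_algebra.
Set Implicit Arguments. Unset Strict Implicit. Unset Printing Implicit Defensive.
Import Order.TTheory GRing.Theory Num.Theory.
Local Open Scope ring_scope.

Notation F3 := 'F_3.

Definition dotp (n : nat) (u v : 'rV[F3]_n) : F3 := \sum_(i < n) u 0 i * v 0 i.

Definition wt (n : nat) (u : 'rV[F3]_n) : nat := #|[set i | u 0 i != 0]|.

Definition is_linear_code (n : nat) (C : {set 'rV[F3]_n}) : bool :=
  (0 \in C) && [forall x, forall y, forall a : F3,
     (x \in C) ==> (y \in C) ==> (a *: x + y \in C)].

Definition dual_code (n : nat) (C : {set 'rV[F3]_n}) : {set 'rV[F3]_n} :=
  [set v | [forall u in C, dotp u v == 0]].

Definition typeIII (n : nat) (C : {set 'rV[F3]_n}) : bool :=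
  [&& is_linear_code C, C == dual_code C & [forall u in C, (3 %| wt u)%N]].

Definition III (n : nat) : {set {set 'rV[F3]_n}} := [set D | typeIII D].

(* Main.v *)
(** Since a^2 = 1 for every nonzero a in F_3, the weight of u is u.u mod 3, so
    Type III codes are exactly the self-dual ones.  Let U be a linear code, x an
    isotropic vector of U^perp outside U, and M = 3^(n/2).  Write N for the
    number of Type III codes D containing U, and N_x for the number of those
    also containing x.  For every isotropic v in U^perp with v.x = 1, the
    vector r = x - v satisfies r.r = 1, and the reflection along r is an
    isometry that fixes U and exchanges x and v, whence N_v = N_x.  Each D
    with x not in D contains M/3 such v, and there are M^2/(9|U|) such v in
    total, so counting pairs (D, v) gives
      3 |U| (N - N_x) = M N_x.
    Taking U = 0 and U = <y> gives the number of Type III codes through one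
    vector and through two independent vectors of C, and the two averages
    follow by exchanging sums. *)
Require Import Defs.
From mathcomp Require Import all_boot all_order all_algebra.
From mathcomp Require Import ring zify.
Set Implicit Arguments.
Unset Strict Implicit.
Unset Printing Implicit Defensive.
Import Order.TTheory GRing.Theory Num.Theory.
Local Open Scope ring_scope.

Section Codes.

Context {n : nat}.
Implicit Types (u v w x y r : 'rV[F3]_n) (A C D U : {set 'rV[F3]_n}).

(** * Dot product and linear codes *)

Lemma dotpC u v : dotp u v = dotp v u.
Proof. by apply: eq_bigr => i _; rewrite mulrC. Qed.

Lemma dotpDl u v w : dotp (u + v) w = dotp u w + dotp v w.
Proof. by rewrite -big_split; apply: eq_bigr => i _; rewrite !mxE mulrDl. Qed.

Lemma dotpZl a u v : dotp (a *: u) v = a * dotp u v.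
Proof.
by rewrite /dotp mulr_sumr; apply: eq_bigr => i _; rewrite mxE mulrA.
Qed.

Lemma dotpDr u v w : dotp u (v + w) = dotp u v + dotp u w.
Proof. by rewrite dotpC dotpDl !(dotpC _ u). Qed.

Lemma dotpZr a u v : dotp u (a *: v) = a * dotp u v.
Proof. by rewrite dotpC dotpZl dotpC. Qed.

Lemma dotpBl u v w : dotp (u - v) w = dotp u w - dotp v w.
Proof. by rewrite -scaleN1r dotpDl dotpZl mulN1r. Qed.

Lemma dotpBr u v w : dotp u (v - w) = dotp u v - dotp u w.
Proof. by rewrite dotpC dotpBl !(dotpC _ u). Qed.

Lemma dotp0l u : dotp 0 u = 0.
Proof. by rewrite -(scale0r u) dotpZl mul0r. Qed.

Lemma dotp0r u : dotp u 0 = 0.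
Proof. by rewrite dotpC dotp0l. Qed.

Lemma dotp_delta i u : dotp (delta_mx 0 i) u = u 0 i.
Proof.
rewrite /dotp (bigD1 i) //= big1 ?mxE ?eqxx ?mul1r ?addr0 // => j neq_ji.
by rewrite mxE (negPf neq_ji) andbF mul0r.
Qed.

Lemma dual_codeP U v :
  reflect (forall u, u \in U -> dotp u v = 0) (v \in dual_code U).
Proof. by rewrite inE; apply: (iffP forall_inP) => H u /H /eqP. Qed.

Lemma linear_codeP A :
  reflect (0 \in A /\ forall a x y, x \in A -> y \in A -> a *: x + y \in A)
          (is_linear_code A).
Proof.
apply: (iffP andP) => -[A0 Alin]; split=> //.
  move=> a x y Ax Ay.
  by have /forallP/(_ y)/forallP/(_ a) := forallP Alin x; rewrite Ax Ay.
apply/forallP=> x; apply/forallP=> y; apply/forallP=> a.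
by apply/implyP=> Ax; apply/implyP=> Ay; apply: Alin.
Qed.

Lemma linear_code0 A : is_linear_code A -> 0 \in A.
Proof. by case/linear_codeP. Qed.

Lemma linear_codeZ A a x : is_linear_code A -> x \in A -> a *: x \in A.
Proof. by case/linear_codeP=> A0 Alin Ax; rewrite -[_ *: _]addr0 Alin. Qed.

Lemma linear_codeD A x y :
  is_linear_code A -> x \in A -> y \in A -> x + y \in A.
Proof. by case/linear_codeP=> _ Alin Ax Ay; rewrite -[x]scale1r Alin. Qed.

Lemma card_nonzero A :
  is_linear_code A -> (#|[pred x in A | x != 0%R]| + 1 = #|A|)%N.
Proof.
move=> Alin; rewrite (cardsD1 0 A) linear_code0 // addnC; congr (_ + _)%N.
by apply: eq_card => x; rewrite !inE andbC.
Qed.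

Lemma linear_dual_code U : is_linear_code (dual_code U).
Proof.
apply/linear_codeP; split=> [|a x y /dual_codeP Ux /dual_codeP Uy].
  by apply/dual_codeP=> u _; rewrite dotp0r.
by apply/dual_codeP=> u Uu; rewrite dotpDr dotpZr Ux // Uy // mulr0 addr0.
Qed.

Lemma wt_dotp u : (wt u)%:R = dotp u u.
Proof.
rewrite /wt -sum1_card natr_sum big_mkcond; apply: eq_bigr => i _.
by rewrite inE; case: (u 0 i) => -[|[|[|m]]] // lt_m3; apply/eqP.
Qed.

(** A dual code is linear, and [u.u = 0] in a self-dual code makes the weight of [u] vanish modulo
    3. *)
Lemma typeIIIE C : typeIII C = (C == dual_code C).
Proof.
apply/and3P/idP => [[]//|/eqP CE]; split; rewrite -?CE //.
  by rewrite CE linear_dual_code.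
apply/forall_inP=> u Cu; have: (wt u)%:R = 0 :> F3.
  by rewrite wt_dotp; move: (Cu); rewrite {1}CE => /dual_codeP ->.
by move/eqP; rewrite -(dvdn_pcharf (pchar_Fp (isT : prime 3))).
Qed.

(** * Equidistribution over F_3 and the size of the dual *)

(** Translation by a multiple of [b] carries one fibre of [g] in [A] onto another, so the three
    fibres have equal size. The map [g] need not be linear: it will also be the quadratic map
    [v.v]. *)
Lemma card_level_shift A (g : 'rV[F3]_n -> F3) b c :
    (forall v a, v \in A -> v + a *: b \in A) ->
    {in A, forall v a, g (v + a *: b) = g v + a} ->
  (3 * #|[set v in A | g v == c]| = #|A|)%N.
Proof.
move=> Ashift gshift.
have level_eq d : #|[set v in A | g v == d]| = #|[set v in A | g v == c]|.
  rewrite -[LHS](card_imset _ (addIr ((c - d) *: b))); apply: eq_card => v.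
  rewrite inE; apply/imsetP/andP => [[w]|[Av /eqP gv]].
    rewrite inE => /andP[Aw /eqP gw] ->; split; first exact: Ashift.
    by rewrite gshift // gw addrC subrK.
  exists (v + (d - c) *: b).
    by rewrite inE Ashift // gshift // gv addrC subrK /=.
  by rewrite -addrA -scalerDl addrA subrK subrr scale0r addr0.
rewrite -[RHS]sum1_card (partition_big g predT) //=.
rewrite (eq_bigr (fun=> #|[set v in A | g v == c]|)).
  by rewrite sum_nat_const card_Fp.
move=> d _; rewrite -(level_eq d) -sum1_card; apply: eq_bigl => v.
by rewrite inE.
Qed.

Lemma card_level A x c : is_linear_code A -> x \notin dual_code A ->
  (3 * #|[set v in A | dotp v x == c]| = #|A|)%N.
Proof.
move=> Alin; rewrite inE => /forall_inPn[a Aa ax_neq0].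
apply: (@card_level_shift A (fun v => dotp v x) ((dotp a x)^-1 *: a) c)
  => [v t Av|v _ t].
  by rewrite linear_codeD ?linear_codeZ.
by rewrite dotpDl !dotpZl mulVf // mulr1.
Qed.

Lemma linear_codeT : is_linear_code [set: 'rV[F3]_n].
Proof. by apply/linear_codeP; split=> *; rewrite inE. Qed.

Lemma dual_codeT v : (v \in dual_code setT) = (v == 0).
Proof.
apply/dual_codeP/eqP => [v0|-> u _]; last exact: dotp0r.
by apply/rowP=> i; rewrite -dotp_delta v0 ?inE ?mxE.
Qed.

(* Double counting of the pairs (u, v) with u in U and u.v = 1. *)
Lemma card_dual_code U :
  is_linear_code U -> (#|U| * #|dual_code U| = 3 ^ n)%N.
Proof.
move=> Ulin; have cardV : #|[set: 'rV[F3]_n]| = (3 ^ n)%N.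
  by rewrite cardsT card_mx card_Fp // mul1n.
(* Each nonzero [u] pairs to 1 with a third of the whole space. *)
have byu : (3 * \sum_(u in U) \sum_(v | dotp u v == 1%R) 1
            = (#|U| - 1) * 3 ^ n)%N.
  rewrite (bigD1 0) ?linear_code0 //= big_pred0 ?add0n; last first.
    by move=> v; rewrite dotp0l eq_sym oner_eq0.
  rewrite big_distrr (eq_bigr (fun=> (3 ^ n)%N)) /=.
    rewrite sum_nat_const; congr (_ * _)%N.
    by rewrite -(card_nonzero Ulin) addnK.
  move=> u /andP[_ u_neq0]; rewrite -cardV.
  rewrite -(card_level 1 linear_codeT (x := u)) ?dual_codeT //.
  rewrite -sum1_card; congr (_ * _)%N; apply: eq_bigl => v.
  by rewrite !inE dotpC.
(* Each [v] outside the dual pairs to 1 with a third of [U]. *)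
have byv : (3 * \sum_(u in U) \sum_(v | dotp u v == 1%R) 1
            = (3 ^ n - #|dual_code U|) * #|U|)%N.
  rewrite (exchange_big_dep predT) //= (bigID (mem (dual_code U))) /=.
  rewrite big1 => [|v /dual_codeP Uv]; last first.
    by rewrite big1 // => u /andP[/Uv->]; rewrite eq_sym oner_eq0.
  rewrite add0n big_distrr (eq_bigr (fun=> #|U|)) /=.
    rewrite sum_nat_const -cardV; congr (_ * _)%N.
    by rewrite cardsT -(cardC (mem (dual_code U))) addKn.
  move=> v v_notin; rewrite -(card_level 1 Ulin v_notin) -sum1_card.
  by congr (_ * _)%N; apply: eq_bigl => u; rewrite inE.
(* These two bounds keep the subtractions in the two counts from truncating. *)
have U_gt0 : (0 < #|U|)%N by apply/card_gt0P; exists 0; apply: linear_code0.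
have leUV : (#|dual_code U| <= 3 ^ n)%N.
  by rewrite -cardV subset_leq_card ?subsetT.
nia.
Qed.

(** [U] lies in its double dual, and applying [card_dual_code] to [U] and to its dual shows that the
    sizes agree. *)
Lemma dual_codeK U : is_linear_code U -> dual_code (dual_code U) = U.
Proof.
move=> Ulin; apply/esym/eqP; rewrite eqEcard; apply/andP; split.
  apply/subsetP=> u Uu; apply/dual_codeP=> v /dual_codeP/(_ u Uu).
  by rewrite dotpC.
have := card_dual_code (linear_dual_code U).
rewrite -(card_dual_code Ulin) mulnC => /eqP; rewrite eqn_pmul2r => [/eqP->//|].
by apply/card_gt0P; exists 0; apply/linear_code0/linear_dual_code.
Qed.

(** * Reflections acting on Type III codes *)

(* The reflection w |-> w - 2 (w.r) / (r.r) r, as -2 = 1 when r.r = 1. *)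
Definition reflection r w := w + dotp w r *: r.

Lemma reflectionK r : dotp r r = 1 -> involutive (reflection r).
Proof.
move=> rr w; rewrite /reflection dotpDl dotpZl rr mulr1 -addrA -scalerDl.
set a := dotp w r; have -> : a + (a + a) = 0.
  by case: a => -[|[|[|m]]] // lt_m3; apply/eqP.
by rewrite scale0r addr0.
Qed.

Lemma dotp_reflection r u v : dotp (reflection r u) v = dotp u (reflection r v).
Proof. by rewrite dotpDl dotpDr dotpZl dotpZr (dotpC v) mulrC. Qed.

(** The reflection is self-adjoint and involutive, hence an isometry, so it commutes with taking
    duals. *)
Lemma typeIII_reflection r D :
  dotp r r = 1 -> typeIII D -> typeIII (reflection r @^-1: D).
Proof.
move=> rr; rewrite !typeIIIE => /eqP DE; apply/eqP/setP=> v.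
rewrite inE {1}DE; apply/dual_codeP/dual_codeP => [Dv u|Dv u Du].
  by rewrite inE => /Dv; rewrite dotp_reflection reflectionK.
by rewrite -dotp_reflection Dv // inE reflectionK.
Qed.

Lemma card_typeIII_swap U x v :
    x \in dual_code U -> v \in dual_code U ->
    dotp x x = 0 -> dotp v v = 0 -> dotp v x = 1 ->
  #|[set D in III n | (U \subset D) && (v \in D)]|
    = #|[set D in III n | (U \subset D) && (x \in D)]|.
Proof.
move=> /dual_codeP Ux /dual_codeP Uv xx vv vx.
pose s := reflection (x - v).
(* The value is [-2 (x.v) = -2], which is 1 in F_3. *)
have rr : dotp (x - v) (x - v) = 1.
  by rewrite dotpBl !dotpBr xx vv (dotpC x) vx; apply/eqP.
have sK : involutive s by apply: reflectionK.
have sx : s x = v.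
  rewrite /s /reflection dotpBr xx (dotpC x) vx sub0r scaleN1r opprB.
  by rewrite addrC subrK.
have sU u : u \in U -> s u = u.
  by move=> Uu; rewrite /s /reflection dotpBr Ux // Uv // subrr scale0r addr0.
have SK : involutive (fun D : {set 'rV[F3]_n} => s @^-1: D).
  by move=> D; apply/setP=> u; rewrite !inE sK.
(* Taking preimages under [s] permutes the Type III codes; the preimage of [D] contains [x] exactly
   when [D] contains [s x = v]. *)
rewrite -[RHS](card_preimset _ (inv_inj SK)); apply: eq_card => D.
have sIII E : typeIII E -> typeIII (s @^-1: E) by apply: typeIII_reflection.
rewrite !inE sx; congr [&& _, _ & _].
  by apply/idP/idP => [/sIII//|/sIII]; rewrite SK.
by apply/subsetP/subsetP => UD u Uu; move: (UD u Uu); rewrite inE sU.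
Qed.

(** Describing [M] by its square avoids halving the exponent until the final theorem. *)
Lemma card_typeIII M D : (M ^ 2 = 3 ^ n)%N -> typeIII D -> #|D| = M.
Proof.
move=> ME; rewrite typeIIIE => /eqP DE.
have := card_dual_code (linear_dual_code D).
by rewrite -!DE -ME mulnn => /eqP; rewrite eqn_sqr => /eqP.
Qed.

(** * Extending a code by an isotropic vector *)

(** Two successive cuts by 3. As [x] is outside [U], the double dual, [v.x] is equidistributed on
    the dual of [U]. On the level [v.x = 1], replacing [v] by [v - a x] keeps the level and turns
    [v.v] into [v.v - 2a = v.v + a]. *)
Lemma card_isotropic_level U x :
    is_linear_code U -> x \in dual_code U -> x \notin U -> dotp x x = 0 ->
  (9 * #|U|
     * #|[set v in dual_code U | (dotp v x == 1%R) && (dotp v v == 0%R)]|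
     = 3 ^ n)%N.
Proof.
move=> Ulin Ux xNU xx; rewrite -(card_dual_code Ulin).
have dualUlin := linear_dual_code U.
rewrite -(@card_level _ x 1 dualUlin) ?dual_codeK //.
set L := [set v in _ | dotp v x == 1].
rewrite -(@card_level_shift L (fun v => dotp v v) (- x) 0).
- have -> : [set v in L | dotp v v == 0]
      = [set v in dual_code U | (dotp v x == 1) && (dotp v v == 0)].
    by apply/setP=> v; rewrite !inE andbA.
  by ring.
- move=> v a; rewrite inE => /andP[Uv /eqP vx].
  rewrite inE linear_codeD ?linear_codeZ -?scaleN1r ?linear_codeZ //=.
  by rewrite dotpDl !dotpZl xx !mulr0 addr0 vx.
move=> v; rewrite inE => /andP[_ /eqP vx] a.
rewrite scalerN dotpBl !dotpBr !dotpZl !dotpZr xx (dotpC x) vx !mulr0 mulr1.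
rewrite subr0 -addrA; congr (_ + _).
by case: a => -[|[|[|k]]] // lt_k3; apply/eqP.
Qed.

Lemma card_typeIII_extend M U x :
    (M ^ 2 = 3 ^ n)%N -> is_linear_code U ->
    x \in dual_code U -> x \notin U -> dotp x x = 0 ->
  (3 * #|U| * #|[set D in III n | U \subset D]|
     = (M + 3 * #|U|)
       * #|[set D in III n | (U \subset D) && (x \in D)]|)%N.
Proof.
move=> ME Ulin Ux xNU xx.
have := card_isotropic_level Ulin Ux xNU xx.
set S := [set v in _ | _].
set N := #|[set D in III n | U \subset D]|.
set Nx := #|[set D in III n | _ && (x \in D)]| => cardS.
(* By the reflection swap, every [v] in [S] lies in [Nx] of the codes. *)
have byv : (\sum_(D in III n | U \subset D) \sum_(v in S | v \in D) 1
            = #|S| * Nx)%N.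
  rewrite (exchange_big_dep (mem S)) /= => [|D v _ /andP[]//].
  rewrite (eq_bigr (fun=> Nx)) ?sum_nat_const // => v Sv; move: (Sv).
  rewrite inE => /and3P[Uv /eqP vx /eqP vv].
  rewrite /Nx -(card_typeIII_swap Ux Uv xx vv vx) -sum1_card.
  by apply: eq_bigl => D; rewrite Uv vx vv !eqxx !inE /= andbA.
(* A code through [x] is orthogonal to [x] and so misses [S]; any other one meets [S] in [M / 3]
   vectors. *)
have byD : (3 * \sum_(D in III n | U \subset D) \sum_(v in S | v \in D) 1
            = M * (N - Nx))%N.
  rewrite (bigID (fun D : {set _} => x \in D)) /= mulnDr.
  rewrite big1 ?muln0 ?add0n => [|D /andP[/andP[+ _] Dx]]; last first.
    rewrite inE typeIIIE => /eqP DE; rewrite big_pred0 // => v.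
    apply/negP=> /andP[]; rewrite inE => /and3P[_ /eqP vx _] Dv.
    move: Dx; rewrite {1}DE => /dual_codeP/(_ v Dv); rewrite vx => /eqP.
    by rewrite oner_eq0.
  rewrite big_distrr (eq_bigr (fun=> (M)%N)) /= => [|D].
    rewrite sum_nat_const mulnC; congr (_ * _)%N.
    rewrite /N -(cardsID [set D : {set 'rV[F3]_n} | x \in D]).
    rewrite [X in (X + _)%N](_ : _ = Nx).
      by rewrite addKn; apply: eq_card => D; rewrite unfold_in !inE andbC.
    by apply: eq_card => D; rewrite !inE andbA.
  rewrite inE => /andP[/andP[DIII /subsetP UD] xND].
  rewrite -(card_typeIII ME DIII); move: DIII; rewrite typeIIIE => /eqP DE.
  have Dlin : is_linear_code D by rewrite DE linear_dual_code.
  rewrite -(card_level 1 Dlin (x := x)) -?DE //.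
  rewrite -sum1_card; congr (_ * _)%N; apply: eq_bigl => v; rewrite !inE.
  have [Dv|] := boolP (v \in D); last by rewrite andbF.
  have Dv0 : forall u, u \in D -> dotp u v = 0.
    by apply/dual_codeP; rewrite -DE.
  (* For [v] in [D], self-orthogonality already gives [v.v = 0] and, since [D] contains [U],
     membership in the dual of [U]; only [v.x = 1] remains. *)
  rewrite Dv0 // eqxx !andbT andbC andb_idr // => _.
  by apply/forall_inP=> u /UD /Dv0 ->.
have leNx : (Nx <= N)%N.
  by apply: subset_leq_card; apply/subsetP=> D; rewrite !inE => /and3P[-> ->].
have M_gt0 : (0 < M)%N by rewrite -(ltn_exp2r _ _ (isT : 0 < 2)%N) ME expn_gt0.
move: byD; rewrite byv => byD.
(* The extra factor [M] lets [M ^ 2 = 9 |U| |S|] eliminate the size of [S]; it is cancelled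
   afterwards. *)
have /eqP : (M * (3 * #|U| * (N - Nx)) = M * (M * Nx))%N.
  have -> : (M * (3 * #|U| * (N - Nx)) = 3 * #|U| * (M * (N - Nx)))%N by ring.
  by rewrite -byD [RHS]mulnA mulnn ME -cardS; ring.
rewrite eqn_pmul2l // => /eqP; rewrite mulnBr => eqM.
have leUN : (3 * #|U| * Nx <= 3 * #|U| * N)%N by rewrite leq_mul2l leNx orbT.
by rewrite mulnDl -eqM subnK.
Qed.

(** * Type III codes through one or two given vectors *)

Lemma card_typeIII_through M C x :
    (M ^ 2 = 3 ^ n)%N -> typeIII C -> x \in C -> x != 0 ->
  ((M + 3) * #|[set D in III n | x \in D]| = 3 * #|III n|)%N.
Proof.
move=> ME; rewrite typeIIIE => /eqP CE Cx x_neq0.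
have sub0 D : D \in III n -> [set 0] \subset D.
  by rewrite inE sub1set => /and3P[/linear_code0].
have lin0 : is_linear_code [set 0 : 'rV[F3]_n].
  apply/linear_codeP; split=> [|a u v /set1P-> /set1P->]; rewrite !inE //.
  by rewrite scaler0 addr0.
have dual0x : x \in dual_code [set 0].
  by apply/dual_codeP=> u /set1P->; rewrite dotp0l.
have xx : dotp x x = 0.
  by move: (Cx); rewrite {1}CE => /dual_codeP; apply.
have := card_typeIII_extend ME lin0 dual0x _ xx.
rewrite inE x_neq0 cards1 muln1 => /(_ isT).
have -> : [set D in III n | [set 0] \subset D] = III n.
  by apply/setP=> D; rewrite !inE andb_idr // => DIII; rewrite sub0 ?inE.
have -> // : [set D in III n | ([set 0] \subset D) && (x \in D)]
    = [set D in III n | x \in D].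
apply/setP=> D; rewrite !inE; have [DIII|//] := boolP (typeIII D).
by rewrite sub0 ?inE.
Qed.

Definition line y := [set a *: y | a : F3].

Lemma mem_line y : y \in line y.
Proof. by apply/imsetP; exists 1; rewrite ?inE ?scale1r. Qed.

Lemma linear_line y : is_linear_code (line y).
Proof.
apply/linear_codeP; split=> [|a _ _ /imsetP[b _ ->] /imsetP[c _ ->]].
  by apply/imsetP; exists 0; rewrite ?inE ?scale0r.
by apply/imsetP; exists (a * b + c); rewrite ?inE // scalerDl scalerA.
Qed.

Lemma line_sub A y : is_linear_code A -> (line y \subset A) = (y \in A).
Proof.
move=> Alin; apply/subsetP/idP => [|Ay _ /imsetP[a _ ->]].
  by apply; apply: mem_line.
exact: linear_codeZ.
Qed.

Lemma card_line y : y != 0 -> #|line y| = 3%N.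
Proof.
move=> y_neq0; rewrite card_imset ?card_Fp // => a b /eqP.
by rewrite -subr_eq0 -scalerBl scaler_eq0 (negPf y_neq0) orbF subr_eq0 => /eqP.
Qed.

(** The extension count with [U] the line of [y]: it has 3 elements, whence [9 = 3 |U|]. *)
Lemma card_typeIII_through2 M C x y :
    (M ^ 2 = 3 ^ n)%N -> typeIII C -> x \in C -> y \in C ->
    y != 0 -> x \notin line y ->
  ((M + 9) * #|[set D in III n | (y \in D) && (x \in D)]|
     = 9 * #|[set D in III n | y \in D]|)%N.
Proof.
move=> ME; rewrite typeIIIE => /eqP CE Cx Cy y_neq0 xNy.
have Cdual u v : u \in C -> v \in C -> dotp u v = 0.
  by move=> Cu; rewrite {1}CE => /dual_codeP; apply.
have dualyx : x \in dual_code (line y).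
  by apply/dual_codeP=> _ /imsetP[a _ ->]; rewrite dotpZl Cdual ?mulr0.
have := card_typeIII_extend ME (linear_line y) dualyx xNy (Cdual x x Cx Cx).
rewrite card_line // => eqN; symmetry; move: eqN.
have sub_line D : D \in III n -> (line y \subset D) = (y \in D).
  by rewrite inE => /and3P[/line_sub].
have -> : [set D in III n | line y \subset D] = [set D in III n | y \in D].
  by apply/setP=> D; rewrite !inE; apply: andb_id2l => ?; rewrite sub_line ?inE.
have -> // : [set D in III n | (line y \subset D) && (x \in D)]
    = [set D in III n | (y \in D) && (x \in D)].
by apply/setP=> D; rewrite !inE; apply: andb_id2l => ?; rewrite sub_line ?inE.
Qed.

(** * First and second moments of the intersection size *)

(** The family [E] is arbitrary so that the second moment can reuse this for the codes of [E]
    through a fixed [y]. *)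
Lemma sum_card_cap (E : {set {set 'rV[F3]_n}}) C :
  (\sum_(D in E) #|C :&: D| = \sum_(x in C) #|[set D in E | x \in D]|)%N.
Proof.
under eq_bigr do rewrite -sum1_card.
rewrite (exchange_big_dep (mem C)) /= => [|D x _]; last first.
  by rewrite inE => /andP[].
apply: eq_bigr => x Cx; rewrite -sum1_card; apply: eq_bigl => D.
by rewrite !inE Cx.
Qed.

Lemma sum_card_cap2 (E : {set {set 'rV[F3]_n}}) C :
  (\sum_(D in E) #|C :&: D| ^ 2
     = \sum_(y in C) \sum_(x in C) #|[set D in E | (y \in D) && (x \in D)]|)%N.
Proof.
have cap_sum D : (#|C :&: D| ^ 2 = \sum_(y in C | y \in D) #|C :&: D|)%N.
  rewrite sum_nat_const -mulnn; congr (_ * _)%N.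
  by apply: eq_card => x; rewrite !inE.
under eq_bigr do rewrite cap_sum.
rewrite (exchange_big_dep (mem C)) /= => [|D x _ /andP[]//].
apply: eq_bigr => y Cy; under [RHS]eq_bigr => x _.
  rewrite (_ : [set D in E | _] = [set D in [set D in E | y \in D] | x \in D]).
    over.
  by apply/setP=> D; rewrite !inE andbA.
by rewrite -sum_card_cap; apply: eq_bigl => D; rewrite inE Cy.
Qed.

Lemma typeIII_moment1 M C : (M ^ 2 = 3 ^ n)%N -> typeIII C ->
  ((M + 3) * \sum_(D in III n) #|C :&: D| = 4 * M * #|III n|)%N.
Proof.
move=> ME CIII; have cardC := card_typeIII ME CIII.
have Clin : is_linear_code C by case/and3P: CIII.
have C0 := linear_code0 Clin.
rewrite sum_card_cap big_distrr (bigD1 0) //=.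
rewrite (eq_bigr (fun=> 3 * #|III n|)%N) => [|x /andP[Cx x_neq0]]; last first.
  by rewrite (card_typeIII_through ME CIII).
have -> : [set D in III n | 0 \in D] = III n.
  apply/setP=> D; rewrite !inE andb_idr // => /and3P[Dlin _ _].
  exact: linear_code0.
(* The zero vector and the [M - 1] others give [(M + 3) + 3 (M - 1) = 4 M]. *)
by rewrite sum_nat_const -cardC -(card_nonzero Clin); ring.
Qed.

Lemma typeIII_moment2 M C : (M ^ 2 = 3 ^ n)%N -> typeIII C ->
  ((M + 3) * (M + 9) * \sum_(D in III n) #|C :&: D| ^ 2
     = 40 * M ^ 2 * #|III n|)%N.
Proof.
move=> ME CIII; have cardC := card_typeIII ME CIII.
have Clin : is_linear_code C by case/and3P: CIII.
have C0 := linear_code0 Clin.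
have D0 D : D \in III n -> 0 \in D by rewrite inE => /and3P[/linear_code0].
have through0 : (\sum_(x in C) #|[set D in III n | (0%R \in D) && (x \in D)]|
                 = \sum_(D in III n) #|C :&: D|)%N.
  rewrite sum_card_cap; apply: eq_bigr => x _; apply: eq_card => D.
  by rewrite !inE; apply: andb_id2l => ?; rewrite D0 ?inE.
have throughS y : y \in C -> y != 0 ->
    ((M + 3) * (M + 9)
       * \sum_(x in C) #|[set D in III n | (y \in D) && (x \in D)]|
     = 36 * M * #|III n|)%N.
  move=> Cy y_neq0.
  have yC : line y \subset C by rewrite line_sub.
  pose T := #|[set D in III n | y \in D]|.
  have TE : ((M + 3) * T = 3 * #|III n|)%N.
    exact: (card_typeIII_through ME CIII).
  (* The 3 multiples of [y] contribute [(M + 9) T] each and the other [M - 3] vectors [9 T] each, in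
     total [12 M T]. *)
  rewrite -mulnA big_distrr (bigID (mem (line y))) /=.
  rewrite (eq_bigr (fun=> (M + 9) * T)%N); last first.
    move=> x /andP[_ /imsetP[a _ ->]]; congr (_ * _)%N; apply: eq_card => D.
    rewrite !inE; apply: andb_id2l => /and3P[Dlin _ _].
    by rewrite andb_idr // => Dy; apply: linear_codeZ.
  rewrite [X in (_ * (_ + X))%N](eq_bigr (fun=> 9 * T)%N); last first.
    by move=> x /andP[Cx xNy]; apply: (card_typeIII_through2 ME CIII).
  rewrite !sum_nat_const.
  have -> : #|[pred x in C | x \in line y]| = 3%N.
    apply: etrans (card_line y_neq0); apply: eq_card => x; rewrite !inE.
    by rewrite andb_idl // => /(subsetP yC).
  have : (#|[pred x in C | x \notin line y]| + 3 = M)%N.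
    rewrite -cardC -(cardsID (line y) C) (setIidPr yC) card_line // addnC.
    by congr (_ + _)%N; apply: eq_card => x; rewrite !inE andbC.
  move: #|[pred x in C | _]| => k kE.
  have -> : (36 * M * #|III n| = 12 * M * (3 * #|III n|))%N by ring.
  by rewrite -TE -kE; ring.
(* The row [y = 0] is the first moment: [4 M (M + 9) + 36 M (M - 1) = 40 M ^ 2]. *)
rewrite sum_card_cap2 big_distrr (bigD1 0) //= through0.
rewrite [X in (_ + X)%N](eq_bigr (fun=> 36 * M * #|III n|)%N)
  => [|y /andP[Cy y_neq0]]; last first.
  exact: throughS.
rewrite sum_nat_const [((M + 3) * _)%N]mulnC -mulnA typeIII_moment1 //.
by rewrite -cardC -(card_nonzero Clin); ring.
Qed.

End Codes.

Theorem theorem5p5 (n : nat) (C : {set 'rV['F_3]_n}) :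
  (n %% 4 = 0)%N -> typeIII C ->
  ((\sum_(D in III n) (#|C :&: D|)%:R) / (#|III n|)%:R : rat)
     = 4 - 4 / ((3%:Q) ^ ((n %/ 2)%:Z - 1) + 1)
  /\
  ((\sum_(D in III n) ((#|C :&: D|) ^ 2)%:R) / (#|III n|)%:R : rat)
     = 40%:R * ((3%:Q) ^+ (n %/ 2)) ^+ 2
       / (((3%:Q) ^+ (n %/ 2) + 3) * ((3%:Q) ^+ (n %/ 2) + 9)).
Proof.
move=> n4 CIII; pose M := (3 ^ (n %/ 2))%N.
have ME : (M ^ 2 = 3 ^ n)%N by rewrite -expnM; congr (_ ^ _)%N; lia.
have N_neq0 : (#|III n|)%:R != 0 :> rat.
  by rewrite pnatr_eq0 -lt0n; apply/card_gt0P; exists C; rewrite inE.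
have M_gt0 : 0 < M%:R :> rat by rewrite ltr0n expn_gt0.
have M3_neq0 : M%:R + 3 != 0 :> rat by rewrite gt_eqF // addr_gt0.
have M9_neq0 : M%:R + 9 != 0 :> rat by rewrite gt_eqF // addr_gt0.
have eq1 := congr1 (fun k : nat => k%:R : rat) (typeIII_moment1 ME CIII).
have eq2 := congr1 (fun k : nat => k%:R : rat) (typeIII_moment2 ME CIII).
(* The exponent [n/2 - 1] is an integer, equal to -1 for [n = 0], so the power always splits as
   [M / 3]; the target of (i) is then [4 M / (M + 3)]. *)
rewrite -!natr_sum expfzDr // -exprnP exprN1.
have -> : 3%:Q ^+ (n %/ 2) = M%:R by rewrite natrX.
clearbody M; rewrite /= !natrM natrD in eq1; rewrite /= !natrM !natrD in eq2.
move: eq1 eq2; set s1 := (\sum_(D in _) _)%:R; set s2 := (\sum_(D in _) _)%:R.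
move=> eq1 eq2; split.
  have -> : s1 = (M%:R + 3) * s1 / (M%:R + 3) by field.
  by rewrite eq1; field; rewrite ?N_neq0 ?M3_neq0 ?N_neq0.
have -> : s2 = (M%:R + 3) * (M%:R + 9) * s2 / ((M%:R + 3) * (M%:R + 9)).
  by field; rewrite M9_neq0.
by rewrite eq2; field; rewrite ?N_neq0 ?M9_neq0 ?M3_neq0 ?N_neq0.
Qed.
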